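(* Assume Martin's Axiom for $\sigma$-centered forcing notions. Let $f:\mathbb R^2\to\mathbb R$. Suppose $p$ is an $f$-approximation with $|X^p|<\mathfrak c$ and $r^*\in\mathbb R\setminus X^p$. Then there is an $f$-approximation $q$ with $p\le q$ and $X^q=X^p\cup\{r^*\}$.
   Context: $\mathfrak c=2^{\aleph_0}$. For $f:\mathbb R^2\to\mathbb R$, an $f$-approximation is a tuple $p=(X,\bar g_0,\bar g_1,\mathcal D)$ such that: (a) $X\subseteq\mathbb R$; (b) $\bar g_\ell=\langle g_{\ell,n}:n<\omega\rangle$ with $g_{\ell,n}:X\to\mathbb R$ for $\ell<2$, $n<\omega$; for $\ell<2$, $x\in X$ put $\bar a_{\ell,x}=\langle g_{\ell,n}(x):n<\omega\rangle$; (c) for all $x,y\in X$, $f(x,y)=\sum_{n=0}^\infty g_{0,n}(x)\cdot g_{1,n}(y)$; (d) $\mathcal D$ is a filter on $\omega$ containing all cofinite subsets of $\omega$ and generated by at most $|X|+\aleph_0$ sets; (e) for $x\in X$, $\ell<2$: $\{n<\omega:g_{\ell,n}(x)\in\{0,\frac1{(n+1)^2}\}\}\in\mathcal D$, and the set $A_{\bar a_{\ell,x}}=\{n<\omega:g_{\ell,n}(x)=\frac1{(n+1)^2}\}$ is $\mathcal D$-positive (its complement is not in $\mathcal D$); (f) no finite union of sets $A_{\bar a_{\ell,x}}$ ($\ell<2$, $x\in X$) belongs to $\mathcal D$; (g) if $(\ell_1,x_1)\neq(\ell_2,x_2)$ with $\ell_1,\ell_2<2$, $x_1,x_2\in X$,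 then $\bar a_{\ell_1,x_1}\neq\bar a_{\ell_2,x_2}$ and $A_{\bar a_{\ell_1,x_1}}\cap A_{\bar a_{\ell_2,x_2}}$ is finite. We write $p=(X^p,\bar g^p_0,\bar g^p_1,\mathcal D^p)$. For $f$-approximations $p,q$: $p\le q$ iff $X^p\subseteq X^q$, $\mathcal D^p\subseteq\mathcal D^q$ and $g^p_{\ell,n}\subseteq g^q_{\ell,n}$ (as functions, i.e. $g^q_{\ell,n}$ extends $g^p_{\ell,n}$) for all $\ell<2$, $n<\omega$. *)

(* Defs.v *)
From Stdlib Require Import RelationClasses.
From mathcomp Require Import all_boot all_order all_algebra.
From mathcomp Require Import all_classical all_reals all_analysis.

Set Implicit Arguments.
Unset Strict Implicit.
Unset Printing Implicit Defensive.

Import Order.TTheory GRing.Theory Num.Theory.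
Import numFieldNormedType.Exports.

Local Open Scope classical_set_scope.
Local Open Scope card_scope.
Local Open Scope ring_scope.

(* |A| < 2^{aleph_0} *)
Definition card_lt_continuum (T : Type) (A : set T) : Prop :=
  A #<= [set: set nat] /\ ~ (A #= [set: set nat]).

(* A forcing notion is a nonempty preordered type, and [le p q] reads
   "p is stronger than q". *)
Section forcing.
Context {P : Type} (le : P -> P -> Prop).

Definition centered (C : set P) : Prop :=
  forall A : set P, finite_set A -> A `<=` C ->
    exists q : P, forall p : P, A p -> le q p.

Definition sigma_centered : Prop :=
  exists C : nat -> set P,
    (forall n : nat, centered (C n)) /\ \bigcup_n C n = [set: P].

Definition forcing_dense (D : set P) : Prop :=
  forall p : P, exists2 q : P, D q & le q p.

Definition forcing_filter (G : set P) : Prop :=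
  [/\ G !=set0,
      (forall p q : P, G p -> le p q -> G q) &
      (forall p q : P, G p -> G q -> exists r : P, [/\ G r, le r p & le r q])].

End forcing.

Definition MA_sigma_centered : Prop :=
  forall (P : Type) (le : P -> P -> Prop),
    PreOrder le -> inhabited P -> sigma_centered le ->
    forall DD : set (set P), card_lt_continuum DD ->
      (forall D : set P, DD D -> forcing_dense le D) ->
      exists G : set P, forcing_filter le G /\
        forall D : set P, DD D -> G `&` D !=set0.

(* A_a = {n | a_n = 1/(n+1)^2} *)
Definition hit_set {R : realType} (a : nat -> R) : set nat :=
  [set n : nat | a n = 1 / (n.+1%:R ^+ 2)].

(* A function g_{l,n} on X is represented by a total function on R, of which
   only the restriction to X is ever used. *)
Record f_approximation (R : realType) (f : R -> R -> R) := FApproximation {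
  dom : set R;
  seqs : 'I_2 -> nat -> R -> R;
  filt : set_system nat;
  approx_sum : forall x y : R, dom x -> dom y ->
    series (fun n : nat => seqs 0 n x * seqs 1 n y) @ \oo --> f x y;
  approx_filter : ProperFilter filt;
  approx_cofinite : forall A : set nat, cofinite_set A -> filt A;
  (* the disjoint sum of dom and nat has cardinality |X| + aleph_0 *)
  approx_generated : exists B : set_system nat,
    B #<= [set: dom + nat] /\ filt = smallest Filter B;
  approx_values : forall (l : 'I_2) (x : R), dom x ->
    filt [set n : nat | seqs l n x = 0 \/ seqs l n x = 1 / (n.+1%:R ^+ 2)];
  approx_positive : forall (l : 'I_2) (x : R), dom x ->
    ~ filt (~` hit_set (fun n : nat => seqs l n x));
  approx_union : forall F : set ('I_2 * R), finite_set F ->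
    (forall lx : 'I_2 * R, F lx -> dom lx.2) ->
    ~ filt (\bigcup_(lx in F) hit_set (fun n : nat => seqs lx.1 n lx.2));
  approx_disjoint : forall (l1 l2 : 'I_2) (x1 x2 : R), dom x1 -> dom x2 ->
    (l1, x1) <> (l2, x2) ->
    (fun n : nat => seqs l1 n x1) <> (fun n : nat => seqs l2 n x2) /\
    finite_set (hit_set (fun n : nat => seqs l1 n x1) `&`
                hit_set (fun n : nat => seqs l2 n x2)) }.

Definition approx_le (R : realType) (f : R -> R -> R)
    (p q : f_approximation f) : Prop :=
  [/\ dom p `<=` dom q,
      filt p `<=` filt q &
      forall (l : 'I_2) (n : nat) (x : R), dom p x ->
        seqs q l n x = seqs p l n x].

(* Main.v *)
Require Import Defs.
From mathcomp Require Import all_boot all_order all_algebra.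
From mathcomp Require Import all_classical all_reals all_analysis.
From mathcomp Require Import lra.

Local Open Scope classical_set_scope.

(** The two new sequences [a = g_0(r)] and [b = g_1(r)] are read off a generic
    filter. A condition is a rational stem approximating [(a, b)], a finite set
    of promises (old sequences) and a set [E] of the old filter [D]; conditions
    with the same stem are compatible, so the forcing is sigma-centered.
    Lengthening a stem must avoid new hits where a promised old sequence hits,
    and must not increase the error of the partial sums attached to the
    promises. Such an error can be corrected: as the old hit sets are almost
    disjoint and [D]-positive, each promised [t] has arbitrarily late positions
    where [t] hits and the other promised sequences vanish, and there the new
    value can be chosen at will. The error of [sum a_n b_n] is corrected at
    positions where all promised sequences vanish, which exist because finite
    unions of hit sets are not in [D]. The new filter is generated by [D] and
    the set [S] of positions where [a] and [b] both take legal values. *)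

(** * Cardinals below the continuum *)

Section continuum.
Set Implicit Arguments.
Unset Strict Implicit.
Local Open Scope card_scope.

Lemma card_lt_continuum_le (T U : Type) (A : set T) (B : set U) :
  A #<= B -> card_lt_continuum B -> card_lt_continuum A.
Proof.
move=> AB [Bc Bnc]; split; first exact: card_le_trans AB Bc.
move=> Ac; apply: Bnc; rewrite card_eq_le Bc /=.
by move: Ac; rewrite card_eq_le => /andP[_ cA]; exact: card_le_trans cA AB.
Qed.

(** By Cantor-Bernstein, the failure of equinumerosity is the absence of an injection of the power
    set, a form that arguments with surjections can refute. *)
Lemma card_lt_continuumP (T : Type) (A : set T) :
  card_lt_continuum A <->
  A #<= [set: set nat] /\ ~ ([set: set nat] #<= A).
Proof.
split=> -[Ac Anc]; split=> // cA; apply: Anc.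
  by rewrite card_eq_le Ac.
by move: cA; rewrite card_eq_le => /andP[].
Qed.

Lemma card_lt_continuum_nat : card_lt_continuum [set: nat].
Proof.
apply/card_lt_continuumP; split.
  by apply/pcard_injP; exists set1 => m n _ _ /seteqP[/(_ m erefl) + _].
move=> /pcard_surjP[f fsurj].
(* Cantor's diagonal set. *)
have [n _ fn] := fsurj [set n | ~ f n n] I.
by have [fnn|nfnn] := pselect (f n n); [move: (fnn)|apply: (nfnn)]; rewrite fn.
Qed.

(** The pairing behind c * c = c; [evens] and [odds] are its projections. *)
Definition interleave (P Q : set nat) : set nat :=
  [set n | if odd n then Q n./2 else P n./2].

Definition evens (S : set nat) := [set n | S n.*2].
Definition odds (S : set nat) := [set n | S n.*2.+1].

Lemma interleaveKl (P Q : set nat) : evens (interleave P Q) = P.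
Proof.
by apply/seteqP; split=> n; rewrite /evens /interleave /= odd_double doubleK.
Qed.

Lemma interleaveKr (P Q : set nat) : odds (interleave P Q) = Q.
Proof.
apply/seteqP; split=> n;
  by rewrite /odds /interleave /= odd_double uphalf_double.
Qed.

Lemma interleave_inj (P Q P' Q' : set nat) :
  interleave P Q = interleave P' Q' -> P = P' /\ Q = Q'.
Proof.
move=> e; split; first by rewrite -(interleaveKl P Q) e interleaveKl.
by rewrite -(interleaveKr P Q) e interleaveKr.
Qed.

(* Given a surjection of [A `|` B] onto [c * c], either its first projection is
   onto on [A], or it maps [B] onto some vertical section. *)
Lemma card_lt_continuumU (T : Type) (A B : set T) :
  card_lt_continuum A -> card_lt_continuum B -> card_lt_continuum (A `|` B).
Proof.
move=> /card_lt_continuumP[/pcard_injP[i iinj] nA].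
move=> /card_lt_continuumP[/pcard_injP[j jinj] nB].
apply/card_lt_continuumP; split.
  (* The tags [set0] and [setT] in the odd places keep the two images apart. *)
  apply/pcard_injP; exists (fun x =>
    if `[< A x >] then interleave (i x) set0 else interleave (j x) setT).
  move=> x y /set_mem ABx /set_mem ABy.
  case: asboolP => Ax; case: asboolP => Ay /interleave_inj[ij].
  - by move=> _; apply: iinj; rewrite ?inE.
  - by move=> /seteqP[_ /(_ 0%N I)].
  - by move=> /seteqP[/(_ 0%N I)].
  - move=> _; apply: jinj; rewrite ?inE //.
      by case: ABx.
    by case: ABy.
move=> /pcard_surjP[s ssurj].
apply: nA; apply/pcard_surjP; exists (evens \o s) => P _.
apply: contrapT => PnA; apply: nB; apply/pcard_surjP; exists (odds \o s) => Q _.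
have [x ABx sx] := ssurj (interleave P Q) I; exists x;
  last by rewrite /= sx interleaveKr.
by case: ABx => // Ax; case: PnA; exists x => //=; rewrite sx interleaveKl.
Qed.

End continuum.

(** * Filters with one extra generator, and sizes of the index sets *)

Section generators.
Set Implicit Arguments.
Unset Strict Implicit.
Local Open Scope card_scope.

(** The sets [A] on the right already form a filter containing [B] and [S], so the smallest such
    filter lies inside it. *)
Lemma smallest_filterU1 (T : Type) (B : set_system T) (S A : set T) :
  smallest Filter (B `|` [set S]) A <->
  exists2 E, smallest Filter B E & E `&` S `<=` A.
Proof.
have FB := smallest_filter_filter B; split.
  move=> /(_ [set K | exists2 E, smallest Filter B E & E `&` S `<=` K]); apply.
  split; first split.
  - by exists setT => //; exact: filterT.
  - move=> P Q [E BE EP] [E' BE' EQ]; exists (E `&` E').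
      exact: (@filterI _ _ FB).
    by move=> x [[Ex E'x] Sx]; split; [exact: EP|exact: EQ].
  - by move=> P Q PQ [E BE EP]; exists E => //; exact: subset_trans PQ.
  - move=> K [BK|->]; first by exists K; [exact: sub_gen_smallest|move=> x []].
    by exists setT; [exact: filterT|move=> x []].
move=> [E BE EA] M [FM BM]; apply: filterS EA _; apply: filterI.
  by apply: BE; split=> // K BK; apply: BM; left.
by apply: BM; right.
Qed.

(** Old codes keep naming the old generators, and the new point [x] serves as the code of [S]. *)
Lemma card_le_generatorsU1 (T : Type) (X : set T) (x : T)
    (B : set_system nat) (S : set nat) :
  ~ X x -> B #<= [set: X + nat] ->
  B `|` [set S] #<= [set: set_type (X `|` [set x]) + nat].
Proof.
move=> nXx /pcard_surjP[g gB]; apply/pcard_surjP.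
exists (fun u => match u with
  | inl y => if pselect (X (\val y)) is left Xy
             then g (inl (Sub (\val y) (mem_set Xy))) else S
  | inr n => g (inr n) end).
move=> A [BA|->].
  have [[y|n] _ gyA] := gB A BA; last by exists (inr n).
  have Xry : (X `|` [set x]) (\val y) by left; exact: set_valP.
  exists (inl (Sub (\val y) (mem_set Xry))) => //=.
  case: pselect => [Xy|]; last by case; exact: set_valP.
  by rewrite -gyA; congr (g (inl _)); exact: val_inj.
have Xrx : (X `|` [set x]) x by right.
exists (inl (Sub x (mem_set Xrx))) => //=.
by case: pselect.
Qed.

Lemma card_lt_continuum_sum (T : Type) (X : set T) :
  card_lt_continuum X -> card_lt_continuum [set: X + nat].
Proof.
move=> Xc; have -> : [set: X + nat] = range inl `|` range inr.
  by apply/seteqP; split=> // -[y|n] _; [left; exists y|right; exists n].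
apply: card_lt_continuumU.
  apply: card_lt_continuum_le Xc; apply: card_le_trans (card_image_le _ _) _.
  by move: (card_setT X); rewrite card_eq_le => /andP[].
by apply: card_lt_continuum_le card_lt_continuum_nat; exact: card_image_le.
Qed.

Lemma ord2_cases (l : 'I_2) : l = 0%R \/ l = 1%R.
Proof. by case: l => -[|[|//]] i; [left|right]; exact: val_inj. Qed.

Lemma card_lt_continuum_ord2 (T : Type) (X : set T) :
  card_lt_continuum X -> card_lt_continuum [set: 'I_2 * X].
Proof.
move=> Xc; have -> : [set: 'I_2 * X] = range (pair 0%R) `|` range (pair 1%R).
  apply/seteqP; split=> // -[l y] _.
  by case: (ord2_cases l) => ->; [left|right]; exists y.
by apply: card_lt_continuumU; apply: card_lt_continuum_le Xc;
  apply: card_le_trans (card_image_le _ _) _;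
  move: (card_setT X); rewrite card_eq_le => /andP[].
Qed.

End generators.

(** * The forcing *)

Section rationals.
Set Implicit Arguments.
Unset Strict Implicit.
Import Order.TTheory GRing.Theory Num.Theory.
Local Open Scope ring_scope.
Context {R : realType}.

(** Take [d] between 0 and [e], close to [e]: the error then cannot grow. By density a second choice
    is available if the first one hits [z]. *)
Lemma rat_correction (e tol z : R) : 0 < tol -> 0 < z ->
  exists d : rat,
    [/\ `|e - ratr d| <= `|e|, `|e - ratr d| <= tol & ratr d != z].
Proof.
move=> tol0 z0; case: (ltgtP e 0) => [e0|e0|->]; last first.
- by exists 0; rewrite rmorph0 subr0 normr0 lexx lt_eqF // ltW.
- have /rat_in_itvoo[d1] : Num.max 0 (e - tol) < e.
    by rewrite gt_max e0 ltrBlDr ltrDl.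
  rewrite in_itv /= gt_max => /andP[/andP[d1_gt0 ed1] d1e].
  have /rat_in_itvoo[d2] := d1e.
  rewrite in_itv /= => /andP[d12 d2e].
  have [d1z|d1z] := eqVneq (ratr d1) z.
    exists d2; split; [rewrite !ger0_norm; lra|rewrite ger0_norm; lra|].
    by rewrite gt_eqF // -d1z.
  by exists d1; split=> //; [rewrite !ger0_norm; lra|rewrite ger0_norm; lra].
- have /rat_in_itvoo[d] : e < Num.min 0 (e + tol).
    by rewrite lt_min e0 ltrDl.
  rewrite in_itv /= lt_min => /andP[ed /andP[d0 de]].
  exists d; split; [rewrite !ler0_norm; lra|rewrite ler0_norm; lra|].
  by rewrite lt_eqF // (lt_trans d0).
Qed.

End rationals.

Section filters.
Set Implicit Arguments.
Unset Strict Implicit.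

Lemma filter_seq (T : Type) (I : eqType) (D : set_system T) {DF : Filter D}
    (A : I -> set T) (F : seq I) :
  (forall t, t \in F -> D (A t)) -> D [set n | forall t, t \in F -> A t n].
Proof.
elim: F => [|t F IH] DA; first by apply: filterS filterT => n _ t.
have DF' := IH (fun s sF => DA s (mem_behead (s := t :: F) sF)).
apply: filterS (filterI (DA t (mem_head t F)) DF') => n [tn Fn] s.
by rewrite inE => /orP[/eqP ->//|]; exact: Fn.
Qed.

Lemma finite_nat_bounded (A : set nat) : finite_set A ->
  exists N, forall n, (N <= n)%N -> ~ A n.
Proof.
move=> /finite_seqP[s ->]; exists (\max_(i <- s) i).+1 => n sn /= ns.
by have := @leq_bigmax_seq _ s xpredT id n ns isT; rewrite leqNgt => /negP;
  apply.
Qed.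

Lemma bounded_finite_nat (A : set nat) N :
  (forall n, (N <= n)%N -> ~ A n) -> finite_set A.
Proof.
move=> AN; apply: sub_finite_set (finite_II N) => n An /=.
by rewrite ltnNge; apply/negP => /AN.
Qed.

End filters.

Section extension.
Set Implicit Arguments.
Unset Strict Implicit.
Import Order.TTheory GRing.Theory Num.Theory.
Local Open Scope ring_scope.
Context {R : realType} {J : choiceType}.
(** [h t] is an old sequence, [side t] tells which new sequence is multiplied with it, and [v] lists
    the sums to be reached. *)
Variables (h : J -> nat -> R) (side : J -> bool) (v : option J -> R).
Variable D : set_system nat.
Context {DF : Filter D}.

Definition inv_sq (n : nat) : R := 1 / (n.+1%:R ^+ 2).

Lemma inv_sq_gt0 n : 0 < inv_sq n.
Proof. by rewrite /inv_sq divr_gt0 // exprn_gt0 // ltr0n. Qed.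

Lemma inv_sq_le1 n : inv_sq n <= 1.
Proof.
by rewrite /inv_sq ler_pdivrMr ?exprn_gt0 ?ltr0n // mul1r exprn_ege1 // ler1n.
Qed.

(* [None] stands for the pair formed by the two new sequences, [Some t] for the
   pairing of the old sequence [h t] with one of them. *)
Definition term (o : option J) (x : R * R) (n : nat) : R :=
  if o is Some t then (if side t then x.1 else x.2) * h t n else x.1 * x.2.

Definition err (c : nat -> R * R) (o : option J) (m : nat) : R :=
  v o - \sum_(i < m) term o (c i) i.

Definition covered (F : seq J) (o : option J) : Prop :=
  if o is Some t then t \in F else True.

(** The first clause makes the two new hit sets almost disjoint from each other, the second from the
    promised old ones. *)
Definition safe (F : seq J) (x : R * R) (i : nat) : Prop :=
  ~ (x.1 = inv_sq i /\ x.2 = inv_sq i) /\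
  forall t, t \in F -> hit_set (h t) i -> x.1 <> inv_sq i /\ x.2 <> inv_sq i.

(** Errors are bounded at every intermediate length, so that whole series converge and not just a
    subsequence of partial sums. *)
Definition segment (F : seq J) (c : nat -> R * R) (m n : nat) : Prop :=
  (forall i, (m <= i < n)%N -> safe F (c i) i) /\
  (forall i o, (m <= i <= n)%N -> covered F o -> `|err c o i| <= `|err c o m|).

Definition avoids (F : seq J) (n : nat) : Prop :=
  forall t, t \in F -> ~ hit_set (h t) n.

(** In order, the clauses serve: no finite union of hit sets in the new filter; positivity of the
    first and of the second new hit set; positivity of the old hit sets; convergence of the sums.
    Each witness carries legal values in both components. *)
Definition progress (F : seq J) (E : set nat) (m : nat)
    (c : nat -> R * R) (n : nat) : Prop :=
  [/\ exists i, [/\ (i < n)%N, E i, avoids F i & c i = (0, 0)],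
      exists i, [/\ (i < n)%N, E i & c i = (inv_sq i, 0)],
      exists i, [/\ (i < n)%N, E i & c i = (0, inv_sq i)],
      forall t, t \in F ->
        exists i, [/\ (i < n)%N, E i, hit_set (h t) i & c i = (0, 0)] &
      forall o, covered F o -> `|err c o n| <= m.+1%:R^-1].

Lemma err_eq (c c' : nat -> R * R) o m :
  (forall i, (i < m)%N -> c i = c' i) -> err c o m = err c' o m.
Proof. by move=> cc'; congr (_ - _); apply: eq_bigr => i _; rewrite cc'. Qed.

Lemma errS c o m : err c o m.+1 = err c o m - term o (c m) m.
Proof. by rewrite /err big_ord_recr /= opprD addrA. Qed.

Lemma term0 o n : term o (0, 0) n = 0.
Proof. by case: o => [t|] /=; rewrite ?if_same mul0r. Qed.

Lemma covered_sub (F F' : seq J) o :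
  {subset F <= F'} -> covered F o -> covered F' o.
Proof. by case: o => //= t; apply. Qed.

Lemma segment_eq F c c' m n : (forall i, (i < n)%N -> c i = c' i) ->
  (m <= n)%N -> segment F c m n -> segment F c' m n.
Proof.
move=> cc' mn [sf er]; split=> [i /andP[mi ni]|i o /andP[mi ni] Fo].
  by rewrite -cc' //; apply: sf; rewrite mi.
rewrite -(err_eq (c := c)) => [|k ki]; last by rewrite cc' // (leq_trans ki).
rewrite -[in leRHS](err_eq (c := c)) => [|k ki].
  by apply: er; rewrite ?mi.
by rewrite cc' // (leq_trans ki).
Qed.

Lemma segment_sub F F' c m n :
  {subset F <= F'} -> segment F' c m n -> segment F c m n.
Proof.
move=> FF' [sf er]; split=> [i /sf[? sfF]|i o imn /(covered_sub FF')].
  by split=> // t /FF'; apply: sfF.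
exact: er.
Qed.

Lemma segment_refl F c m : segment F c m m.
Proof.
split=> i; first by case/andP => mi /(leq_ltn_trans mi); rewrite ltnn.
by move=> o; rewrite -eqn_leq => /eqP ->.
Qed.

Lemma segment_trans F c k m n : (k <= m <= n)%N ->
  segment F c k m -> segment F c m n -> segment F c k n.
Proof.
move=> /andP[km mn] [sf er] [sf' er'].
split=> [i /andP[ki ni]|i o /andP[ki ni] Fo].
  by have [im|mi] := ltnP i m; [apply: sf|apply: sf']; apply/andP.
have [im|mi] := leqP i m; first by apply: er; rewrite ?ki.
apply: le_trans (er' _ _ _ Fo) (er _ _ _ Fo); last by rewrite km /=.
by rewrite ltnW.
Qed.

Lemma progress_eq F E k c c' n : (forall i, (i < n)%N -> c i = c' i) ->
  progress F E k c n -> progress F E k c' n.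
Proof.
move=> cc' [[i0 [? ? ? c0]] [i1 [? ? c1]] [i2 [? ? c2]] c3 c4]; split.
- by exists i0; split=> //; rewrite -cc'.
- by exists i1; split=> //; rewrite -cc'.
- by exists i2; split=> //; rewrite -cc'.
- by move=> t /c3[i [? ? ? ct]]; exists i; split=> //; rewrite -cc'.
- by move=> o; rewrite -(err_eq (c := c)) //; exact: c4.
Qed.

(** Witnesses below [n] stay below [n'], and the added segment does not let errors grow. *)
Lemma progress_le F F' E E' k k' c n n' :
  {subset F <= F'} -> E' `<=` E -> (k <= k')%N -> (n <= n')%N ->
  segment F' c n n' -> progress F' E' k' c n -> progress F E k c n'.
Proof.
move=> FF' EE' kk' nn' [_ er]; have ltn' i : (i < n)%N -> (i < n')%N.
  by move=> /leq_trans; apply.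
move=> [[i0 [? ? av c0]] [i1 [? ? c1]] [i2 [? ? c2]] c3 c4]; split.
- by exists i0; split; auto => t /FF'; exact: av.
- by exists i1; split; auto.
- by exists i2; split; auto.
- by move=> t /FF' /c3[i [? ? ? ct]]; exists i; split; auto.
- move=> o /(covered_sub FF') Fo; apply: le_trans (er _ _ _ Fo) _.
    by rewrite nn' leqnn.
  apply: le_trans (c4 _ Fo) _.
  by rewrite lef_pV2 ?posrE ?ltr0n // ler_nat.
Qed.

(** Rational entries leave only countably many stems, as sigma-centeredness requires. *)
Definition stem : Type := seq (rat * rat).

(** Past its end a stem reads as zero pairs, which contribute nothing to any sum. *)
Definition sval (s : stem) (n : nat) : R * R :=
  (ratr (nth (0, 0) s n).1, ratr (nth (0, 0) s n).2).

Definition extends (s s' : stem) : Prop :=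
  (size s <= size s')%N /\ forall i, (i < size s)%N -> sval s' i = sval s i.

Definition sext (F : seq J) (s s' : stem) : Prop :=
  extends s s' /\ segment F (sval s') (size s) (size s').

Lemma extends_refl s : extends s s. Proof. by []. Qed.

Lemma extends_trans s1 s2 s3 :
  extends s1 s2 -> extends s2 s3 -> extends s1 s3.
Proof.
move=> [l12 e12] [l23 e23]; split=> [|i i1]; first exact: leq_trans l23.
by rewrite e23 ?e12 // (leq_trans i1).
Qed.

Lemma sext_refl F s : sext F s s.
Proof. by split; [exact: extends_refl|exact: segment_refl]. Qed.

Lemma sext_trans F s1 s2 s3 : sext F s1 s2 -> sext F s2 s3 -> sext F s1 s3.
Proof.
move=> [e12 s12] [e23 s23]; split; first exact: extends_trans e23.
apply: segment_trans s23; first by rewrite e12.1 e23.1.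
by apply: segment_eq s12; [move=> i i2; rewrite e23.2|exact: e12.1].
Qed.

Lemma sext_sub F F' s s' : {subset F <= F'} -> sext F' s s' -> sext F s s'.
Proof. by move=> FF' [e seg]; split=> //; exact: segment_sub seg. Qed.

Lemma sval_set_nth s n x i : (size s <= n)%N ->
  sval (set_nth (0, 0) s n x) i =
  if i == n then (ratr x.1, ratr x.2) else sval s i.
Proof. by move=> sn; rewrite /sval nth_set_nth /=; case: eqP. Qed.

Lemma sval_default s n : (size s <= n)%N -> sval s n = (0, 0).
Proof. by move=> sn; rewrite /sval nth_default //= !rmorph0. Qed.

(** The padding between [size s] and [n] consists of zero pairs, which never hit and leave every
    error unchanged; only the entry at [n] has to be checked. *)
Lemma sext_set_nth F s n (x : rat * rat) : (size s <= n)%N ->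
  safe F (ratr x.1, ratr x.2) n ->
  (forall o, covered F o ->
    `|err (sval s) o (size s) - term o (ratr x.1, ratr x.2) n|
      <= `|err (sval s) o (size s)|) ->
  let s' := set_nth (0, 0) s n x in
  [/\ sext F s s', size s' = n.+1, sval s' n = (ratr x.1, ratr x.2) &
      forall o, err (sval s') o (size s') =
        err (sval s) o (size s) - term o (ratr x.1, ratr x.2) n].
Proof.
move=> sn sf er s'.
have ss' : size s' = n.+1.
  by rewrite size_set_nth; apply/maxn_idPl; rewrite ltnW.
have vs' i : sval s' i = if i == n then (ratr x.1, ratr x.2) else sval s i.
  exact: sval_set_nth.
have flat o i : (size s <= i <= n)%N ->
    err (sval s') o i = err (sval s) o (size s).
  elim: i => [|i IH] /andP[si ni].
    move: si; rewrite leqn0 => /eqP ->.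
    by apply: err_eq.
  move: si; rewrite leq_eqVlt => /orP[/eqP ->|si].
    by apply: err_eq => j ji; rewrite vs' ltn_eqF // (leq_trans ji).
  have {}IH := IH (introT andP (conj si (ltnW ni))).
  by rewrite errS IH vs' (ltn_eqF ni) sval_default // term0 subr0.
have last o : err (sval s') o (size s') =
    err (sval s) o (size s) - term o (ratr x.1, ratr x.2) n.
  by rewrite ss' errS flat ?sn ?leqnn // vs' eqxx.
split=> //; last by rewrite vs' eqxx.
split; first split.
- by rewrite ss' ltnW.
- by move=> i si; rewrite vs' ltn_eqF // (leq_trans si).
split=> [i|i o] /andP[si].
  rewrite ss' ltnS leq_eqVlt => /orP[/eqP ->|ni]; first by rewrite vs' eqxx.
  rewrite vs' ltn_eqF // sval_default //.
  have /eqP u0 := lt_eqF (inv_sq_gt0 i).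
  by split=> [[/= /u0]|t _ _ /=].
rewrite [err _ _ (size s)]flat ?leqnn // leq_eqVlt => /orP[/eqP ->|].
  by rewrite last; exact: er.
by rewrite ss' ltnS => ni _; rewrite flat ?si.
Qed.

(** * Lengthening a stem at positions supplied by [D] *)

Hypothesis cofD : forall N, D [set n | (N <= n)%N].
Hypothesis hval : forall t, D [set n | h t n = 0 \/ h t n = inv_sq n].
Hypothesis hpos : forall t, ~ D (~` hit_set (h t)).
Hypothesis hunion : forall F : seq J,
  ~ D [set n | exists2 t, t \in F & hit_set (h t) n].
Hypothesis hdisj : forall t t', t != t' ->
  exists N, forall n, (N <= n)%N -> hit_set (h t) n -> ~ hit_set (h t') n.

(** Otherwise the late positions of [E] with legal promised values would all lie in the union of the
    promised hit sets, against [hunion]. *)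
Lemma free_position F E N : D E -> exists n,
  [/\ (N <= n)%N, E n, avoids F n & forall t, t \in F -> h t n = 0].
Proof.
move=> DE.
have /= DG : D (E `&` [set n | (N <= n)%N] `&` [set n | forall t, t \in F ->
    h t n = 0 \/ h t n = inv_sq n]).
  by apply: filterI; [exact: filterI|apply: (filter_seq (fun t _ => hval t))].
apply: contrapT => nex; apply: (hunion (F := F)); apply: filterS DG.
move=> n [[En Nn] vn]; apply: contrapT => nh; apply: nex; exists n; split=> //.
  by move=> t tF hn; apply: nh; exists t.
move=> t tF; case: (vn t tF) => // hn.
by case: nh; exists t.
Qed.

(** Positivity yields a hit of [t] inside any set of [D]; far enough out, almost disjointness
    excludes hits of the other promised sequences, whose legal values are then 0. *)
Lemma hit_position (F : seq J) E N t : D E -> exists n,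
  [/\ (N <= n)%N, E n, hit_set (h t) n &
      forall t', t' \in F -> t' != t -> h t' n = 0].
Proof.
move=> DE.
have Dd t' : t' \in F ->
    D [set n | t' != t -> hit_set (h t) n -> ~ hit_set (h t') n].
  have [->|] := eqVneq t' t; first by move=> _; apply: filterS filterT.
  rewrite eq_sym => /hdisj[M hM] _; apply: filterS (cofD M) => n /hM hn _.
  exact: hn.
have /= DG : D (E `&` [set n | (N <= n)%N] `&` [set n | forall t', t' \in F ->
    h t' n = 0 \/ h t' n = inv_sq n] `&` [set n | forall t', t' \in F ->
    t' != t -> hit_set (h t) n -> ~ hit_set (h t') n]).
  apply: filterI; last exact: (filter_seq Dd).
  by apply: filterI; [exact: filterI|apply: (filter_seq (fun t _ => hval t))].
apply: contrapT => nex; apply: (hpos (t := t)); apply: filterS DG.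
move=> n [[[En Nn] vn] dn] hn; apply: nex; exists n; split=> // t' t'F t't.
by case: (vn t' t'F) => // h't; case: (dn t' t'F t't hn).
Qed.

Lemma ratr_inv_sq n : ratr (1 / (n.+1%:R ^+ 2)) = inv_sq n.
Proof.
by rewrite /inv_sq rmorphM /= rmorph1 fmorphV rmorphXn /= ratr_nat.
Qed.

Lemma safe_avoids F x n : avoids F n ->
  (x.1 <> inv_sq n \/ x.2 <> inv_sq n) -> safe F x n.
Proof.
move=> av x12; split; first by case=> x1 x2; case: x12.
by move=> t /av.
Qed.

Lemma term_free F x n o : (forall t, t \in F -> h t n = 0) -> covered F o ->
  x.1 * x.2 = 0 -> term o x n = 0.
Proof. by case: o => [t|] //= h0 /h0 -> _; rewrite mulr0. Qed.

(** Where all promised sequences vanish, an entry with a zero component changes no covered sum. *)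
Lemma add_free F E N s (x : nat -> rat * rat) : D E ->
  (forall n, (x n).1 = 0 \/ (x n).2 = 0) ->
  exists s', sext F s s' /\ exists n,
    [/\ (N <= n < size s')%N, E n, avoids F n &
        sval s' n = (ratr (x n).1, ratr (x n).2)].
Proof.
move=> DE x0.
have [n [Nn En av hn]] := free_position F (maxn N (size s)) DE.
move: Nn; rewrite geq_max => /andP[Nn sn].
have /eqP u0 := lt_eqF (inv_sq_gt0 n).
have [|o Fo|] := @sext_set_nth F s n (x n) sn.
- by apply: safe_avoids => //=; case: (x0 n) => ->; rewrite rmorph0; auto.
- rewrite (term_free hn) ?subr0 //=.
  by case: (x0 n) => ->; rewrite rmorph0 ?mulr0 ?mul0r.
move=> se ss sv _; exists (set_nth (0, 0) s n (x n)); split=> //.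
by exists n; rewrite ss sv Nn ltnSn.
Qed.

Lemma add_hit F E s t : D E -> t \in F ->
  exists s', sext F s s' /\ exists n,
    [/\ (n < size s')%N, E n, hit_set (h t) n & sval s' n = (0, 0)].
Proof.
move=> DE tF; have [n [sn En hn h0]] := hit_position F (size s) t DE.
have /eqP u0 := lt_eqF (inv_sq_gt0 n).
have [||] := @sext_set_nth F s n (0, 0) sn.
- by split=> [[/=]|t' _ _ /=]; rewrite rmorph0.
- by move=> o _; rewrite /= !rmorph0 term0 subr0.
move=> se ss; rewrite /= !rmorph0 => sv _.
by exists (set_nth (0, 0) s n (0, 0)); split=> //; exists n; rewrite ss ltnSn.
Qed.

Lemma correct_err F s o (tol : R) : 0 < tol -> covered F o ->
  exists s', sext F s s' /\ `|err (sval s') o (size s')| <= tol.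
Proof.
move=> tol0; set e := err (sval s) o (size s).
case: o @e => [t|] e Fo; last first.
  (* [(d / 2, 2)] changes the sum of products by [d] and, as [2] is not of the
     form [1 / (n + 1)^2], does not make both new sequences hit. *)
  have [n [sn _ av h0]] := free_position F (size s) filterT.
  have [d [d1 d2 _]] := rat_correction e tol0 ltr01.
  have dE : ratr (d / 2) * ratr 2 = ratr d :> R.
    by rewrite -rmorphM /= divfK.
  have [|[t|] /= Fo'|] := @sext_set_nth F s n (d / 2, 2) sn.
  - apply: safe_avoids => //=; right; apply/eqP; rewrite gt_eqF //.
    by apply: le_lt_trans (inv_sq_le1 n) _; rewrite ratr_nat ltr1n.
  - by rewrite h0 // mulr0 subr0.
  - by rewrite dE.
  move=> se _ _ /(_ None); rewrite /= dE => er.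
  by exists (set_nth (0, 0) s n (d / 2, 2)); rewrite er.
have [n [sn _ hn h0]] := hit_position F (size s) t filterT.
have u0 := inv_sq_gt0 n.
have [d [d1 d2 dz]] := rat_correction e tol0 (mulr_gt0 u0 u0).
(* Writing [w] at [n] changes the sum attached to [t] by [d]; excluding one
   value of [d] prevents [w] from being a hit where [t] hits. *)
pose w := d * n.+1%:R ^+ 2.
have wE : ratr w * inv_sq n = ratr d.
  by rewrite -ratr_inv_sq -rmorphM /= /w mulrA mulr1 mulfK //
    expf_neq0 // pnatr_eq0.
have wu : ratr w <> inv_sq n by move=> wu; move: dz; rewrite -wE wu eqxx.
have u0' : 0 <> inv_sq n by apply/eqP; rewrite lt_eqF.
(* Only the component multiplied with [h t] is nonzero, so the product of the new sequences gains
   nothing; the other promised sequences vanish at [n]. *)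
pose x := if side t then (w, 0) else (0, w).
have tE : term (Some t) (ratr x.1, ratr x.2) n = ratr d.
  by rewrite /= /x; case: (side t); rewrite /= hn.
have [||] := @sext_set_nth F s n x sn.
- by rewrite /x; split=> [[]|? _ _]; case: (side t); rewrite /= rmorph0.
- move=> [t'|] Fo'; last first.
    by rewrite /= /x; case: (side t); rewrite /= rmorph0 ?mulr0 ?mul0r subr0.
  have [->|t't] := eqVneq t' t; first by rewrite tE.
  by rewrite /= h0 // mulr0 subr0.
move=> se _ _ /(_ (Some t)); rewrite tE => er.
by exists (set_nth (0, 0) s n x); rewrite er.
Qed.

(** Requirements that survive further lengthening can be met one after another. *)
Lemma sext_all (I : eqType) F (Q : I -> stem -> Prop) (L : seq I) s :
  (forall i s s', sext F s s' -> Q i s -> Q i s') ->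
  (forall i s, i \in L -> exists s', sext F s s' /\ Q i s') ->
  exists s', sext F s s' /\ forall i, i \in L -> Q i s'.
Proof.
move=> Qm; elim: L => [|i L IH] QL.
  by exists s; split; [exact: sext_refl|].
have [j s0 jL|s1 [e1 Q1]] := IH; first by apply: QL; rewrite inE jL orbT.
have [s2 [e2 Q2]] := QL i s1 (mem_head _ _).
exists s2; split; first exact: sext_trans e2.
by move=> j; rewrite inE => /orP[/eqP ->//|/Q1]; exact: Qm.
Qed.

Lemma sext_progress F E N s : D E -> exists s',
  [/\ sext F s s', (N <= size s')%N &
      progress F E (size s) (sval s') (size s')].
Proof.
move=> DE.
have later s1 s2 : sext F s1 s2 -> forall i, (i < size s1)%N ->
    (i < size s2)%N /\ sval s2 i = sval s1 i.
  by move=> [[l12 e12] _] i i1; split; [exact: leq_trans l12|exact: e12].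
have [s1 [e1 [i1 [/andP[N1 l1] E1 a1 v1]]]] :=
  add_free F N s (x := fun=> (0, 0)) DE (fun=> or_introl erefl).
have [s2 [e2 [i2 [/andP[_ l2] E2 a2 v2]]]] :=
  add_free F 0 s1 (x := fun n => (1 / (n.+1%:R ^+ 2), 0)) DE
    (fun=> or_intror erefl).
have [s3 [e3 [i3 [/andP[_ l3] E3 a3 v3]]]] :=
  add_free F 0 s2 (x := fun n => (0, 1 / (n.+1%:R ^+ 2))) DE
    (fun=> or_introl erefl).
have [|t s0 tF|s4 [e4 Q4]] := @sext_all J F (fun t s0 => exists i,
    [/\ (i < size s0)%N, E i, hit_set (h t) i & sval s0 i = (0, 0)]) F s3.
- move=> t s0 s' /later le0 [i [l Ei hi v0]]; exists i.
  by have [? ->] := le0 _ l.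
- exact: add_hit.
have [ o s0 s' e0 /= er Fo|o s0 _|s5 [e5 Q5]] := @sext_all (option J) F
  (fun o s0 => covered F o ->
     `|err (sval s0) o (size s0)| <= (size s).+1%:R^-1) (None :: map Some F) s4.
- apply: le_trans (er Fo); case: e0 => -[l0 v0] [_ /(_ (size s') o)].
  rewrite l0 leqnn => /(_ erefl Fo) /le_trans; apply.
  by rewrite (err_eq (c' := sval s0)).
- have [Fo|nFo] := pselect (covered F o); last first.
    by exists s0; split; [exact: sext_refl|].
  have [|s' [? ?]] := @correct_err F s0 o (size s).+1%:R^-1 _ Fo.
    by rewrite invr_gt0 ltr0n.
  by exists s'.
have e35 := sext_trans e4 e5; have e25 := sext_trans e3 e35.
have e15 := sext_trans e2 e25.
have [l15 v15] := later _ _ e15 _ l1; have [l25 v25] := later _ _ e25 _ l2.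
have [l35 v35] := later _ _ e35 _ l3.
exists s5; split; first exact: sext_trans e15.
  exact: leq_trans N1 (ltnW l15).
split.
- by exists i1; split=> //; rewrite v15 v1 /= rmorph0.
- by exists i2; split=> //; rewrite v25 v2 /= ratr_inv_sq rmorph0.
- by exists i3; split=> //; rewrite v35 v3 /= ratr_inv_sq rmorph0.
- move=> t /Q4[i [l Ei hi vi]]; have [? v'] := later _ _ e5 _ l.
  by exists i; rewrite v'.
- move=> o Fo; apply: Q5 => //; case: o Fo => [t|] //= Ft.
  by rewrite inE /= map_f.
Qed.

(** * The forcing order, its centeredness and its dense sets *)

Record condition := Condition {
  cstem : stem;
  cprom : seq J;
  cset : set nat;
  cset_filter : D cset }.

(* Asking every strict lengthening to make progress lets the generic filter be
   controlled by dense sets indexed by lengths, single promises and single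
   generators of [D], with no need to count finite sets of them. *)
Definition cle (q p : condition) : Prop :=
  [/\ {subset cprom p <= cprom q}, cset q `<=` cset p,
      sext (cprom p) (cstem p) (cstem q) &
      (size (cstem p) < size (cstem q))%N ->
      progress (cprom p) (cset p) (size (cstem p))
        (sval (cstem q)) (size (cstem q))].

(** Nothing is lengthened, so the progress clause holds vacuously. *)
Lemma cle_same_stem (q p : condition) : cstem q = cstem p ->
  {subset cprom p <= cprom q} -> cset q `<=` cset p -> cle q p.
Proof.
by move=> qp Fpq Eqp; split; rewrite ?qp ?ltnn //; exact: sext_refl.
Qed.

Lemma cle_refl p : cle p p.
Proof. exact: cle_same_stem. Qed.

Lemma cle_trans p q r : cle p q -> cle q r -> cle p r.
Proof.
move=> [Fqp Epq spq gpq] [Frq Eqr sqr gqr].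
have sqp := sext_sub Frq spq; split.
- by move=> t /Frq /Fqp.
- exact: subset_trans Eqr.
- exact: sext_trans sqp.
- move=> lrp; case: (spq) => -[lqp vqp] seg.
  (* Either [q] is already longer than [r], and its progress persists in [p]; or [q] and [r] have
     equal lengths, and the progress of [p] over [q], made for more promises and a smaller set,
     suffices. *)
  have [lrq|lqr] := ltnP (size (cstem r)) (size (cstem q)).
    apply: (progress_le (fun _ => id) (@subset_refl _ _) (leqnn _) lqp sqp.2).
    by apply: progress_eq (gqr lrq) => i /vqp.
  have rq : size (cstem r) = size (cstem q).
    by apply/eqP; rewrite eqn_leq lqr sqr.1.1.
  rewrite rq in lrp *; apply: (progress_le Frq Eqr _ _ _ (gpq lrp)) => //.
  exact: segment_refl.
Qed.

Lemma cle_PreOrder : RelationClasses.PreOrder cle.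
Proof.
split; [exact: cle_refl|move=> p q r; exact: cle_trans].
Qed.

Lemma cle_sigma_centered : sigma_centered cle.
Proof.
exists (fun n => [set p | pickle (cstem p : seq (rat * rat)) = n]);
  split; last first.
  by apply/seteqP; split=> // p _; exists (pickle (cstem p : seq (rat * rat))).
move=> n A /(@finite_seqP {classic condition})[L ->] LC.
(* The default matters only for a code without a stem, where [L] is empty and any stem will do. *)
pose s : stem := odflt [::] (unpickle n).
have {}LC p : p \in L -> cstem p = s.
  by move=> /LC /= pn; rewrite /s -pn pickleK.
suff [q [_ qL]] : exists q, cstem q = s /\ forall p, p \in L -> cle q p.
  by exists q => p /qL.
elim: L LC => [|p L IH] LC; first by exists (@Condition s [::] setT filterT).
have [q [qs qL]] := IH (fun p' p'L => LC p' (mem_behead (s := p :: L) p'L)).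
have ps := LC p (mem_head _ _).
exists (@Condition s (cprom p ++ cprom q) (cset p `&` cset q)
  (filterI (cset_filter p) (cset_filter q))); split=> // p'.
rewrite inE => /orP[/eqP ->|/qL p'q].
  by apply: cle_same_stem => [|t tp|k []] //=; rewrite mem_cat tp.
apply: cle_trans p'q; apply: cle_same_stem => [|t tp|k []] //=.
by rewrite mem_cat tp orbT.
Qed.

Lemma dense_length n : forcing_dense cle [set p | (n <= size (cstem p))%N].
Proof.
move=> p; have [s [es ns ps]] :=
  sext_progress (cprom p) n (cstem p) (cset_filter p).
by exists (@Condition s (cprom p) (cset p) (cset_filter p)) => //=; split.
Qed.

Lemma dense_promise t : forcing_dense cle [set p | t \in cprom p].
Proof.
move=> p; exists (@Condition (cstem p) (t :: cprom p) (cset p) (cset_filter p)).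
  exact: mem_head.
by apply: cle_same_stem => //= t' tp; rewrite inE tp orbT.
Qed.

Lemma dense_cset A : D A -> forcing_dense cle [set p | cset p `<=` A].
Proof.
move=> DA p; exists (@Condition (cstem p) (cprom p) (cset p `&` A)
  (filterI (cset_filter p) DA)); first by move=> k [].
by apply: cle_same_stem => // k [].
Qed.

(** The dense sets are indexed by lengths, by [J] and by [B], hence are fewer than the continuum;
    the pair is the union of the stems in the generic filter. *)
Lemma exists_generic_pair (B : set_system nat) :
  MA_sigma_centered -> card_lt_continuum [set: J] -> card_lt_continuum B ->
  D = smallest Filter B ->
  exists c : nat -> R * R,
    [/\ forall o (e : R), 0 < e ->
          exists N, forall m, (N <= m)%N -> `|err c o m| <= e,
        forall F E, D E -> exists n, progress F E 0 c n &
        forall F, exists N, forall n, (N <= n)%N -> safe F (c n) n].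
Proof.
move=> MA Jc Bc DB.
have BD A : B A -> D A by rewrite DB => BA M [_]; exact.
have [||DD|G [[G0 Gup Gdir] Gmeet]] :=
  MA condition cle cle_PreOrder _ cle_sigma_centered
  (range (fun n => [set p | (n <= size (cstem p))%N]) `|`
   range (fun t => [set p | t \in cprom p]) `|`
   ((fun A => [set p | cset p `<=` A]) @` B)).
- by constructor; exact: (@Condition [::] [::] setT filterT).
- apply: card_lt_continuumU; last first.
    by apply: card_lt_continuum_le Bc; exact: card_image_le.
  apply: card_lt_continuumU.
    by apply: card_lt_continuum_le card_lt_continuum_nat; exact: card_image_le.
  by apply: card_lt_continuum_le Jc; exact: card_image_le.
- case=> [[|]|] [x xB <-]; [exact: dense_length|exact: dense_promise|].
  by apply: dense_cset; exact: BD.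
have Glen n : exists2 p, G p & (n <= size (cstem p))%N.
  by have [|p [Gp np]] := Gmeet [set p | (n <= size (cstem p))%N];
    [left; left; exists n|exists p].
(* The sets that include [cset p] for some [p] in [G] form a filter, so meeting the generators takes
   care of all of [D]. *)
have Gset A : D A -> exists2 p, G p & cset p `<=` A.
  move=> DA; have : smallest Filter B A by rewrite -DB.
  move=> /(_ [set K | exists2 p, G p & cset p `<=` K]); apply; split.
    split.
    - by case: G0 => p Gp; exists p.
    - move=> P Q [p Gp pP] [q Gq qQ]; have [r [Gr rp rq]] := Gdir p q Gp Gq.
      exists r => // k rk; split.
        by apply: pP; case: rp => _ + _ _; exact.
      by apply: qQ; case: rq => _ + _ _; exact.
    - by move=> P Q PQ [p Gp pP]; exists p => //; exact: subset_trans PQ.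
  move=> b Bb; have [|p [Gp pb]] := Gmeet [set p | cset p `<=` b];
    last by exists p.
  by right; exists b.
have Gprom (F : seq J) E : D E ->
    exists p, [/\ G p, {subset F <= cprom p} & cset p `<=` E].
  move=> DE; elim: F => [|t F [p [Gp Fp pE]]].
    by have [p Gp pE] := Gset E DE; exists p; split.
  have [|q [Gq /= tq]] := Gmeet [set p | t \in cprom p].
    by left; right; exists t.
  have [r [Gr [Fpr Erp _ _] [Fqr _ _ _]]] := Gdir p q Gp Gq.
  exists r; split=> //; last exact: subset_trans pE.
  by move=> t'; rewrite inE => /orP[/eqP ->|/Fp /Fpr]; first exact: Fqr.
(* A stem of length at least [n.+1] has a genuine entry at [n]; directedness of [G] makes the choice
   of stem irrelevant. *)
have [pick pickP] := choice (fun n => (exists2P _ _).1 (Glen n.+1)).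
pose c n := sval (cstem (pick n)) n.
have cE p : G p -> forall i, (i < size (cstem p))%N -> sval (cstem p) i = c i.
  move=> Gp i ip; have [Gi il] := pickP i.
  have [r [_ [_ _ [[_ rp] _] _] [_ _ [[_ ri] _] _]]] := Gdir _ _ Gp Gi.
  by rewrite -rp // ri.
have Gnext p N : G p -> exists q, [/\ G q, cle q p & (N <= size (cstem q))%N].
  move=> Gp; have [p' Gp' Np'] := Glen N.
  have [q [Gq qp [_ _ [[l _] _] _]]] := Gdir _ _ Gp Gp'.
  by exists q; split=> //; exact: leq_trans l.
(* The promises of [p] bind the whole generic sequence, as longer and longer stems below [p] occur
   in [G]. *)
have Gseg p n : G p -> (size (cstem p) <= n)%N ->
    segment (cprom p) c (size (cstem p)) n.
  move=> Gp pn; have [q [Gq [_ _ [[l _] [sf er]] _] nq]] := Gnext p n Gp.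
  have eqc := cE q Gq; apply: (segment_eq (c := sval (cstem q))) => //.
    by move=> i /leq_trans/(_ nq); exact: eqc.
  split=> [i /andP[pi ni]|i o /andP[pi ni]].
    by apply: sf; rewrite pi (leq_trans ni).
  by apply: er; rewrite pi (leq_trans ni).
have Gprog p : G p -> exists q, [/\ G q, (size (cstem p) < size (cstem q))%N,
    cle q p & progress (cprom p) (cset p) (size (cstem p)) c (size (cstem q))].
  move=> Gp; have [q [Gq qp pq]] := Gnext p (size (cstem p)).+1 Gp.
  exists q; split=> //; case: (qp) => _ _ _ /(_ pq).
  by apply: progress_eq => i; exact: cE.
exists c; split.
- move=> o e e0.
  have [p [Gp op _]] :=
    Gprom (if o is Some t then [:: t] else [::]) setT filterT.
  have [N Ne] : exists N : nat, N.+1%:R^-1 <= e.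
    exists (Num.truncn e^-1); rewrite invf_ple ?posrE ?ltr0n //.
    by apply/ltW; exact: truncnS_gt.
  have [q [Gq [pq _ _ _] Nq]] := Gnext p N Gp.
  have [r [Gr qr [rq _ _ _] [_ _ _ _ er]]] := Gprog q Gq.
  have oq : covered (cprom q) o.
    by case: o op {er} => //= t tp; apply/pq/tp; rewrite mem_head.
  exists (size (cstem r)) => m rm; have [_ er'] := Gseg r m Gr rm.
  have oR := covered_sub rq oq.
  apply: le_trans (er' m o _ oR) _; first by rewrite rm leqnn.
  apply: le_trans (er o oq) _; apply: le_trans Ne.
  by rewrite lef_pV2 ?posrE ?ltr0n // ler_nat ltnS.
- move=> F E DE; have [p [Gp Fp pE]] := Gprom F E DE.
  have [q [Gq _ _ pq]] := Gprog p Gp; exists (size (cstem q)).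
  by apply: (progress_le Fp pE _ _ _ pq) => //; exact: segment_refl.
- move=> F; have [p [Gp Fp _]] := Gprom F setT filterT.
  exists (size (cstem p)) => n pn.
  have [+ _] := segment_sub Fp (Gseg p n.+1 Gp (leqW pn)).
  by apply; rewrite pn ltnS leqnn.
Qed.

End extension.

(** * Adjoining the new point *)

Section adjoin.
Set Implicit Arguments.
Unset Strict Implicit.
Import Order.TTheory GRing.Theory Num.Theory.
Import numFieldNormedType.Exports.
Local Open Scope card_scope.
Local Open Scope ring_scope.
Context {R : realType} {f : R -> R -> R} (p : f_approximation f) (r : R).

#[local] Instance filt_filter : Filter (filt p) := approx_filter p.

Definition old_index : choiceType := ('I_2 * dom p)%type.

Definition old (t : old_index) (n : nat) : R := seqs p t.1 n (\val t.2).

(** An old g_1(x) is multiplied by the new g_0(r), with sum f(r, x); an old g_0(x) by the new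
    g_1(r), with sum f(x, r). *)
Definition pairs_left (t : old_index) : bool := t.1 == 1.

Definition target (o : option old_index) : R :=
  if o is Some t then
    if pairs_left t then f r (\val t.2) else f (\val t.2) r
  else f r r.

Definition index_of (l : 'I_2) (x : R) (px : dom p x) : old_index :=
  (l, Sub x (mem_set px)).

Lemma old_inj (t t' : old_index) : t != t' ->
  (t.1, \val t.2) <> (t'.1, \val t'.2).
Proof.
case: t t' => l y [l' y'] /eqP tt' [ll' /val_inj yy'].
by apply: tt'; rewrite ll' yy'.
Qed.

Lemma exists_adjoined_pair : MA_sigma_centered -> card_lt_continuum (dom p) ->
  exists c : nat -> R * R,
    [/\ forall o (e : R), 0 < e -> exists N, forall m, (N <= m)%N ->
          `|err old pairs_left target c o m| <= e,
        forall F E, filt p E ->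
          exists n, progress old pairs_left target F E 0 c n &
        forall F, exists N, forall n, (N <= n)%N -> safe old F (c n) n].
Proof.
move=> MA pc.
have [B [Bc pB]] := approx_generated p.
apply: (@exists_generic_pair _ _ old pairs_left target (filt p) _
  _ _ _ _ _ B) => //.
- move=> N; apply: approx_cofinite; apply: bounded_finite_nat (N) _ => n Nn.
  exact.
- by move=> [l y]; apply: approx_values; exact: set_valP.
- by move=> [l y]; apply: approx_positive; exact: set_valP.
- move=> F pF.
  apply: (@approx_union _ _ p [set (t.1, \val t.2) | t in [set` F]]).
  + by apply: finite_image; exact: finite_seq.
  + by move=> _ [t _ <-]; exact: set_valP.
  + apply: filterS pF => n [t tF tn].
    by exists (t.1, \val t.2) => //; exists t.
- move=> t t' tt'; have [|_ fin] := @approx_disjoint _ _ p t.1 t'.1 _ _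
    (set_valP t.2) (set_valP t'.2); first exact: old_inj.
  have [N AN] := finite_nat_bounded fin.
  by exists N => n Nn tn t'n; apply: (AN n Nn).
- exact: card_lt_continuum_ord2.
- by apply: card_lt_continuum_le Bc _; exact: card_lt_continuum_sum.
Qed.

(** * Checking the clauses of the extended approximation *)

Hypothesis nr : ~ dom p r.
Variable c : nat -> R * R.
Hypothesis c_sum : forall o (e : R), 0 < e ->
  exists N, forall m, (N <= m)%N -> `|err old pairs_left target c o m| <= e.
Hypothesis c_progress : forall F E, filt p E ->
  exists n, progress old pairs_left target F E 0 c n.
Hypothesis c_safe : forall F, exists N, forall n, (N <= n)%N ->
  safe old F (c n) n.

Definition component (l : 'I_2) (x : R * R) : R := if l == 0 then x.1 else x.2.

Definition adjoin_seqs (l : 'I_2) (n : nat) (x : R) : R :=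
  if x == r then component l (c n) else seqs p l n x.

Definition good_set : set nat := [set n |
  ((c n).1 = 0 \/ (c n).1 = 1 / (n.+1%:R ^+ 2)) /\
  ((c n).2 = 0 \/ (c n).2 = 1 / (n.+1%:R ^+ 2))].

(** An explicit form of the filter generated by [filt p] and [good_set], which makes membership easy
    to refute by a single position. *)
Definition adjoin_filt : set_system nat :=
  [set A | exists2 E, filt p E & E `&` good_set `<=` A].

Lemma adjoin_seqs_old (t : old_index) n :
  adjoin_seqs t.1 n (\val t.2) = old t n.
Proof.
rewrite /adjoin_seqs; case: eqP => // tr.
by case: nr; rewrite -tr; exact: set_valP.
Qed.

Lemma adjoin_seqs_new l n : adjoin_seqs l n r = component l (c n).
Proof. by rewrite /adjoin_seqs eqxx. Qed.

Lemma cvg_sum o : series (fun n => term old pairs_left o (c n) n) @ \oo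
  --> target o.
Proof.
apply/cvgrPdist_le => e e0; have [N cN] := c_sum o e0.
near=> m; rewrite seriesEnat /= big_mkord; apply: cN.
by near: m; exact: nbhs_infty_ge.
Unshelve. all: by end_near. Qed.

Lemma adjoin_domP x : (dom p `|` [set r]) x ->
  (exists y : dom p, x = \val y) \/ x = r.
Proof.
by case=> [px|->]; [left; exists (Sub x (mem_set px))|right].
Qed.

Lemma adjoin_sum x y : (dom p `|` [set r]) x -> (dom p `|` [set r]) y ->
  series (fun n => adjoin_seqs 0 n x * adjoin_seqs 1 n y) @ \oo --> f x y.
Proof.
move=> /adjoin_domP[[x' ->]|->] /adjoin_domP[[y' ->]|->].
- have := @approx_sum _ _ p _ _ (set_valP x') (set_valP y').
  under eq_fun do rewrite -[seqs p 0 _ _](adjoin_seqs_old (0, x'))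
    -[seqs p 1 _ _](adjoin_seqs_old (1, y')).
  by [].
- under eq_fun do rewrite (adjoin_seqs_old (0, x')) adjoin_seqs_new mulrC.
  exact: (@cvg_sum (Some (0, x'))).
- under eq_fun do rewrite (adjoin_seqs_old (1, y')) adjoin_seqs_new.
  exact: (@cvg_sum (Some (1, y'))).
- under eq_fun do rewrite !adjoin_seqs_new.
  exact: (@cvg_sum None).
Qed.

Lemma adjoin_filt_sub : filt p `<=` adjoin_filt.
Proof. by move=> A pA; exists A => // n []. Qed.

Lemma free_witness (F : seq old_index) E : filt p E ->
  exists n, [/\ E n, avoids old F n & c n = (0, 0)].
Proof. by move=> /(c_progress F)[_ [[n [_ ? ? ?]] _ _ _ _]]; exists n. Qed.

(** Old hits are found where the new pair is zero, new hits where the other component is zero; both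
    kinds of position are in [good_set]. *)
Lemma hit_witness l x E : (dom p `|` [set r]) x -> filt p E ->
  exists n, [/\ E n, good_set n & hit_set (fun n => adjoin_seqs l n x) n].
Proof.
move=> /adjoin_domP[[x' ->]|->] pE.
  have [m [_ _ _ hE _]] := c_progress [:: ((l, x') : old_index)] pE.
  have [n [_ En hn cn]] := hE (l, x') (mem_head _ _).
  exists n; split=> //; first by rewrite /good_set /= cn /=; split; left.
  by rewrite /hit_set /= (adjoin_seqs_old (l, x')).
have [_ [_ [n0 [_ E0 c0]] [n1 [_ E1 c1]] _ _]] := c_progress [::] pE.
rewrite /good_set /hit_set /=; case: (ord2_cases l) => ->.
  exists n0; rewrite adjoin_seqs_new c0; split=> //.
  by split; [right|left].
exists n1; rewrite adjoin_seqs_new c1; split=> //.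
by split; [left|right].
Qed.

Lemma adjoin_proper : ProperFilter adjoin_filt.
Proof.
split.
  move=> [E pE E0]; have [n [En _ cn]] := free_witness [::] pE.
  by apply: (E0 n); split=> //; rewrite /good_set /= cn /=; split; left.
split.
- by exists setT => //; exact: filterT.
- move=> P Q [E pE EP] [E' pE' EQ]; exists (E `&` E'); first exact: filterI.
  by move=> x [[Ex E'x] Sx]; split; [exact: EP|exact: EQ].
- by move=> P Q PQ [E pE EP]; exists E => //; exact: subset_trans PQ.
Qed.

Lemma adjoin_generated : exists B : set_system nat,
  B #<= [set: set_type (dom p `|` [set r]) + nat] /\
  adjoin_filt = smallest Filter B.
Proof.
have [B [Bc pB]] := approx_generated p; exists (B `|` [set good_set]).
split; first exact: card_le_generatorsU1.
by apply/seteqP; split=> A; rewrite /adjoin_filt /= pB;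
  move/smallest_filterU1.
Qed.

Lemma adjoin_values l x : (dom p `|` [set r]) x -> adjoin_filt
  [set n | adjoin_seqs l n x = 0 \/ adjoin_seqs l n x = 1 / (n.+1%:R ^+ 2)].
Proof.
move=> /adjoin_domP[[x' ->]|->].
  have px' := @approx_values _ _ p l _ (set_valP x').
  apply: adjoin_filt_sub; apply: filterS px' => n.
  by rewrite /= (adjoin_seqs_old (l, x')).
exists setT => [|n [_ [good1 good2]] /=]; first exact: filterT.
by rewrite adjoin_seqs_new; case: (ord2_cases l) => ->.
Qed.

Lemma adjoin_positive l x : (dom p `|` [set r]) x ->
  ~ adjoin_filt (~` hit_set (fun n => adjoin_seqs l n x)).
Proof.
move=> qx [E pE Eh]; have [n [En gn]] := hit_witness l qx pE.
exact: Eh.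
Qed.

(** At a position of [E] that avoids the finitely many old hit sets in [F] and carries the new pair
    (0, 0), no member of [F] hits, although the position is in [good_set]. *)
Lemma adjoin_union (F : set ('I_2 * R)) : finite_set F ->
  (forall lx, F lx -> (dom p `|` [set r]) lx.2) ->
  ~ adjoin_filt (\bigcup_(lx in F) hit_set (fun n => adjoin_seqs lx.1 n lx.2)).
Proof.
move=> finF qF [E pE EF].
have /finite_seqP[L FL] : finite_set [set t : old_index | F (t.1, \val t.2)].
  apply: (@finite_preimage _ _ F (fun t : old_index => (t.1, \val t.2))) => //.
  by move=> t t' _ _; apply: contra_eq => /old_inj/eqP.
have [n [En avn cn]] := free_witness L pE.
have [|[l x] Flx] := EF n.
  by split=> //; rewrite /good_set /= cn /=; split; left.
have /eqP u0 : 0 != inv_sq n :> R by rewrite lt_eqF // inv_sq_gt0.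
have /adjoin_domP[[x' xx']|->] := qF _ Flx; rewrite /hit_set /=; last first.
  by rewrite adjoin_seqs_new cn /component; case: ifP.
rewrite /= in xx'; rewrite xx' (adjoin_seqs_old (l, x')); apply: avn.
have : [set t : old_index | F (t.1, \val t.2)] (l, x') by rewrite /= -xx'.
by rewrite FL.
Qed.

Lemma new_disjoint (t : old_index) l :
  finite_set (hit_set (fun n => adjoin_seqs t.1 n (\val t.2)) `&`
              hit_set (fun n => adjoin_seqs l n r)).
Proof.
have [N sN] := c_safe [:: t]; apply: (bounded_finite_nat (N := N)) => n Nn.
rewrite /hit_set /= adjoin_seqs_old adjoin_seqs_new => -[tn].
have [_ /(_ t (mem_head _ _) tn)[]] := sN n Nn.
by rewrite /component; case: ifP.
Qed.

Lemma adjoin_disjoint l1 l2 x1 x2 :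
  (dom p `|` [set r]) x1 -> (dom p `|` [set r]) x2 -> (l1, x1) <> (l2, x2) ->
  (fun n => adjoin_seqs l1 n x1) <> (fun n => adjoin_seqs l2 n x2) /\
  finite_set (hit_set (fun n => adjoin_seqs l1 n x1) `&`
              hit_set (fun n => adjoin_seqs l2 n x2)).
Proof.
(* Almost disjointness implies distinctness: equal sequences would have a finite hit set, whose
   cofinite complement contradicts positivity. *)
move=> q1 q2 ne; suff fin : finite_set
    (hit_set (fun n => adjoin_seqs l1 n x1) `&`
     hit_set (fun n => adjoin_seqs l2 n x2)).
  split=> // e; apply: (adjoin_positive (l := l2) q2).
  apply: adjoin_filt_sub; apply: approx_cofinite; rewrite setCK.
  by move: fin; rewrite e setIid.
case: (adjoin_domP q1) (adjoin_domP q2) ne => [[y1 ->]|->] [[y2 ->]|->] ne.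
- have [_] := approx_disjoint (set_valP y1) (set_valP y2) ne.
  by under eq_fun do rewrite -[seqs p l1 _ _](adjoin_seqs_old (l1, y1));
     under [X in _ `&` hit_set X]eq_fun do
       rewrite -[seqs p l2 _ _](adjoin_seqs_old (l2, y2)).
- exact: (new_disjoint (l1, y1)).
- by rewrite setIC; exact: (new_disjoint (l2, y2)).
(* Both sequences are new, so [l1] and [l2] differ; safety without promises forbids simultaneous
   hits. *)
- have [N sN] := c_safe [::]; apply: (bounded_finite_nat (N := N)) => n Nn.
  rewrite /hit_set /= !adjoin_seqs_new => -[].
  have [+ _] := sN n Nn.
  case: (ord2_cases l1) (ord2_cases l2) ne => -> [] -> // _ ns u1 u2.
    exact: ns.
  by apply: ns.
Qed.

Definition adjoin : f_approximation f :=
  @FApproximation R f (dom p `|` [set r]) adjoin_seqs adjoin_filt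
    adjoin_sum adjoin_proper
    (fun A cA => adjoin_filt_sub (approx_cofinite p cA))
    adjoin_generated adjoin_values adjoin_positive adjoin_union adjoin_disjoint.

Lemma approx_le_adjoin : approx_le p adjoin.
Proof.
split=> [x px|A|l n x px]; [by left|exact: adjoin_filt_sub|].
exact: (adjoin_seqs_old (index_of l px)).
Qed.

End adjoin.

Theorem theorem3p3 (MA : MA_sigma_centered) (R : realType) (f : R -> R -> R)
    (p : f_approximation f) (hp : card_lt_continuum (dom p))
    (r : R) (hr : ~ dom p r) :
  exists q : f_approximation f, approx_le p q /\ dom q = dom p `|` [set r].
Proof.
have [c [c_sum c_progress c_safe]] := exists_adjoined_pair r MA hp.
exists (adjoin hr c_sum c_progress c_safe).
by split=> //; exact: approx_le_adjoin.
Qed.
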